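(* Let $T$ be a compact metric space and let $\Theta=C(T,\mathbb{R}^n)\times C(T,\mathbb{R})$ be equipped with a norm inducing the uniform convergence topology. Define the feasible set mapping $\mathcal{F}_{SIP}:\Theta\rightrightarrows\mathbb{R}^n$ by $$\mathcal{F}_{SIP}(\sigma)=\{x\in\mathbb{R}^n : a_t^\top x\le b_t\ \ \forall t\in T\},\qquad \sigma=(a,b)\in\Theta.$$ Let $\overline{\sigma}=(\overline{a},\overline{b})\in\operatorname{dom}\mathcal{F}_{SIP}$. If $\mathcal{F}_{SIP}(\overline{\sigma})$ is bounded, then $$\operatorname{Lipusc}\mathcal{F}_{SIP}(\overline{\sigma})=\sup_{x\in\mathcal{F}_{SIP}(\overline{\sigma})}\operatorname{clm}\mathcal{F}_{SIP}(\overline{\sigma},x).$$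
   Context: $C(T,\mathbb{R}^n)$ and $C(T,\mathbb{R})$ are the spaces of continuous functions on $T$; for $(a,b)\in\Theta$ write $a_t=a(t)$, $b_t=b(t)$. A typical norm on $\Theta$ is $\|(a,b)\|=\max(\|a\|_\infty,\|b\|_\infty)$. $\mathbb{R}^n$ carries the metric of a fixed norm. For a set-valued mapping $\mathcal{M}:Y\rightrightarrows X$ between metric spaces, $\operatorname{dom}\mathcal{M}=\{y\in Y: \mathcal{M}(y)\neq\emptyset\}$ and $\operatorname{gph}\mathcal{M}=\{(y,x)\in Y\times X: x\in\mathcal{M}(y)\}$. The point-to-set distance is $d_X(x,\Omega)=\inf_{z\in\Omega}d_X(x,z)$, with $d_X(x,\emptyset)=+\infty$. Lipschitz upper semicontinuity modulus: for $\overline{y}\in\operatorname{dom}\mathcal{M}$, $\operatorname{Lipusc}\mathcal{M}(\overline{y})\in[0,+\infty]$ is the infimum of all $\kappa\ge 0$ for which there is a neighborhood $V$ of $\overline{y}$ with $d_X(x,\mathcal{M}(\overline{y}))\le\kappa\, d_Y(y,\overline{y})$ for all $y\in V$ and all $x\in\mathcal{M}(y)$ (with $\inf\emptyset=+\infty$). Calmness modulus: for $(\overline{y},\overline{x})\in\operatorname{gph}\mathcal{M}$, $\operatorname{clm}\mathcal{M}(\overline{y},\overline{x})\in[0,+\infty]$ is the infimum of all $\kappa\ge 0$ for which there are neighborhoods $V$ of $\overline{y}$ and $U$ of $\overline{x}$ with $d_X(x,\mathcal{M}(\overline{y}))\le\kappa\, d_Y(y,\overline{y})$ for all $y\in V$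 and all $x\in\mathcal{M}(y)\cap U$ (with $\inf\emptyset=+\infty$). *)

(* Defs.v *)
From HB Require Import structures.
From mathcomp Require Import all_boot all_order all_algebra.
From mathcomp Require Import all_classical all_reals all_analysis.

Set Implicit Arguments.
Unset Strict Implicit.
Unset Printing Implicit Defensive.

Import Order.TTheory GRing.Theory Num.Theory.
Import numFieldNormedType.Exports.

Local Open Scope classical_set_scope.
Local Open Scope ring_scope.

Record lmod_norm (R : realType) (V : lmodType R) := LmodNorm {
  lmod_normf :> V -> R ;
  lmod_norm_triangle : forall x y,
    lmod_normf (x + y) <= lmod_normf x + lmod_normf y ;
  lmod_normZ : forall (l : R) x, lmod_normf (l *: x) = `|l| * lmod_normf x ;
  lmod_norm0_eq0 : forall x, lmod_normf x = 0 -> x = 0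
}.

(* [normed_by N] is V with the topology, the norm and the metric of N; any
   topology that V itself may carry (such as the max-norm one on matrices) is
   not inherited. *)
Definition normed_by (R : realType) (V : lmodType R) (N : lmod_norm V) : Type :=
  V.

Section NormedBy.
Context (R : realType) (V : lmodType R) (N : lmod_norm V).

HB.instance Definition _ := GRing.Lmodule.copy (normed_by N) V.

HB.instance Definition _ := Lmodule_isNormed.Build R (normed_by N)
  (@lmod_norm_triangle _ _ N) (@lmod_normZ _ _ N) (@lmod_norm0_eq0 _ _ N).

Let dist (x y : normed_by N) : R := `|x - y|.

Let dist_ge0 x y : 0 <= dist x y.
Proof. exact: normr_ge0. Qed.

Let dist_positivity x y : dist x y = 0 -> x = y.
Proof. by move=> /normr0_eq0/eqP; rewrite subr_eq0 => /eqP. Qed.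

Let ballEdist x d : ball x d = [set y | dist x y < d].
Proof. by rewrite -ball_normE. Qed.

HB.instance Definition _ := PseudoMetric_isMetric.Build R (normed_by N)
  dist_ge0 dist_positivity ballEdist.

End NormedBy.

Section ContinuousLmodule.
Context (R : realType) (T : topologicalType) (V : normedModType R).
Implicit Types f g h : continuousType T V.

Let cst0_continuous : continuous (fun _ : T => 0 : V).
Proof. by move=> x; exact: cvg_cst. Qed.

Let opp_fun_continuous f : continuous (fun t => - f t).
Proof. by move=> x; apply: cvgN; exact: cts_fun. Qed.

Let add_fun_continuous f g : continuous (fun t => f t + g t).
Proof. by move=> x; apply: cvgD; exact: cts_fun. Qed.

Let scale_fun_continuous (k : R) f : continuous (fun t => k *: f t).
Proof. by move=> x; apply: cvgZr; exact: cts_fun. Qed.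

Let zero : continuousType T V := mkcts cst0_continuous.
Let opp f : continuousType T V := mkcts (opp_fun_continuous (f := f)).
Let add f g : continuousType T V := mkcts (add_fun_continuous (f := f) (g := g)).
Let scale (k : R) f : continuousType T V :=
  mkcts (scale_fun_continuous (k := k) (f := f)).

Let addA : associative add.
Proof. by move=> f g h; apply/continuousEP => t; exact: addrA. Qed.
Let addC : commutative add.
Proof. by move=> f g; apply/continuousEP => t; exact: addrC. Qed.
Let add0 : left_id zero add.
Proof. by move=> f; apply/continuousEP => t; exact: add0r. Qed.
Let addN : left_inverse zero opp add.
Proof. by move=> f; apply/continuousEP => t; exact: addNr. Qed.

HB.instance Definition _ :=
  GRing.isZmodule.Build (continuousType T V) addA addC add0 addN.

Let scaleA k l f : scale k (scale l f) = scale (k * l) f.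
Proof. by apply/continuousEP => t; exact: scalerA. Qed.
Let scale1 : left_id 1 scale.
Proof. by move=> f; apply/continuousEP => t; exact: scale1r. Qed.
Let scaleDr : right_distributive scale +%R.
Proof. by move=> k f g; apply/continuousEP => t; exact: scalerDr. Qed.
Let scaleDl f : {morph scale^~ f : k l / k + l}.
Proof. by move=> k l; apply/continuousEP => t; exact: scalerDl. Qed.

HB.instance Definition _ := GRing.Zmodule_isLmodule.Build R (continuousType T V)
  scaleA scale1 scaleDr scaleDl.

End ContinuousLmodule.

Section Moduli.
Context (R : realType) (Y X : metricType R).
Implicit Types M : Y -> set X.

Definition svdom M : set Y := [set y | M y !=set0].

(* The moduli are defined for every y0 (and x0); they are meaningful for y0 in
   svdom M (resp. x0 in M y0).  ereal_inf set0 = +oo gives both conventions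
   inf of the empty set = +oo and dist_to_set x set0 = +oo. *)
Definition dist_to_set (x : X) (A : set X) : \bar R :=
  ereal_inf [set (mdist x z)%:E | z in A].

Definition Lipusc M (y0 : Y) : \bar R :=
  ereal_inf [set k%:E | k in [set k : R | 0 <= k /\
    exists2 V : set Y, nbhs y0 V &
      forall y x, V y -> M y x ->
        (dist_to_set x (M y0) <= (k * mdist y y0)%:E)%E]].

Definition clm M (y0 : Y) (x0 : X) : \bar R :=
  ereal_inf [set k%:E | k in [set k : R | 0 <= k /\
    exists V : set Y, exists U : set X, [/\ nbhs y0 V, nbhs x0 U &
      forall y x, V y -> M y x -> U x ->
        (dist_to_set x (M y0) <= (k * mdist y y0)%:E)%E]]].

End Moduli.

Section SemiInfinite.
Context (R : realType) (T : metricType R) (n : nat).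

(* Continuity into 'cV[R]_n refers to the library (max-norm) topology, which in
   finite dimension is that of any norm on 'cV[R]_n. *)
Definition Theta : lmodType R :=
  (continuousType T 'cV[R]_n * continuousType T R)%type.

Definition Theta_uniform (s : Theta) :
    {uniform T -> 'cV[R]_n} * {uniform T -> R} :=
  (s.1 : T -> 'cV[R]_n, s.2 : T -> R).

(* [initial_topology Theta_uniform] is Theta with the topology of uniform
   convergence of both components. *)
Definition induces_uniform_topology (N : lmod_norm Theta) : Prop :=
  forall s : Theta,
    nbhs (s : normed_by N) = nbhs (s : initial_topology Theta_uniform).

Definition F_SIP (NT : lmod_norm Theta) (NX : lmod_norm 'cV[R]_n)
    (s : normed_by NT) : set (normed_by NX) :=
  [set x : 'cV[R]_n | forall t, ((s.1 t)^T *m x) 0 0 <= s.2 t].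

End SemiInfinite.

Arguments F_SIP {R T n} NT NX s _.

(* Main.v *)
Require Import Defs.
From mathcomp Require Import all_boot all_order all_algebra.
From mathcomp Require Import all_classical all_reals all_analysis.
From mathcomp Require Import ring.
Import Order.TTheory GRing.Theory Num.Theory.
Import numFieldNormedType.Exports.
Local Open Scope classical_set_scope.
Local Open Scope ring_scope.

(* Given k > sup clm, calmness at each point of the compact set F(s) and a
   finite subcover give the Lipschitz estimate on a neighborhood of F(s), so
   only upper semicontinuity is at stake: F(y) must lie in it for y near s.
   Fix x0 in F(s) and a ball B(x0, r) containing F(s). The closed ball is
   compact and no point of it outside F(s) is nearly feasible for y near s. A
   point z of F(y) at distance >= r from x0 is excluded too: x0 is nearly
   feasible for y, hence by convexity so is the point of the segment [x0, z]
   at distance r from x0, which is not in F(s). *)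

Lemma coord_le_mx_norm {R : realType} (m p : nat) (A : 'M[R]_(m, p)) i j :
  `|A i j| <= `|A|.
Proof.
rewrite [leRHS]/Num.norm/= mx_normrE.
by apply/bigmax_geP; right => /=; exists (i, j).
Qed.

(** * Equivalence of norms and compact balls in finite dimension *)

Section FiniteDimension.
Context {R : realType} {n : nat} (N : lmod_norm 'cV[R]_n).

(* Rows, because the library's Heine-Borel theorem is about 'rV. *)
Definition of_row (v : 'rV[R]_n) : normed_by N := v^T.

Lemma of_row_bounded : exists2 C : R, 0 < C & forall v, `|of_row v| <= C * `|v|.
Proof.
pose C := \sum_(i < n) `|delta_mx i 0 : normed_by N|.
have C0 : 0 <= C by apply: sumr_ge0.
(* Adding 1 keeps the constant positive when n = 0, where the sum is empty. *)
exists (C + 1) => [|v]; first by rewrite ltr_wpDl.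
have -> : of_row v = \sum_(i < n) v 0 i *: (delta_mx i 0 : normed_by N).
  apply/colP => i; rewrite (@summxE _ n 1) (bigD1 i)//= big1 => [|j ji].
    by rewrite /of_row !mxE !eqxx mulr1 addr0.
  by rewrite !mxE eq_sym (negbTE ji) mulr0.
apply: (le_trans (ler_norm_sum _ _ _)); rewrite mulrDl mul1r mulr_suml.
apply: ler_wpDr => //; apply: ler_sum => i _.
by rewrite normrZ mulrC ler_wpM2l// coord_le_mx_norm.
Qed.

Lemma of_row_continuous : continuous of_row.
Proof.
have [C C0 le_C] := of_row_bounded.
move=> v; apply/(@cvgrPdist_lt _ (normed_by N) _ (nbhs v)) => e e0.
near=> w; rewrite -[X in `|X|]/(of_row v - of_row w).
have -> : of_row v - of_row w = of_row (v - w) by rewrite /of_row linearB.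
rewrite (le_lt_trans (le_C _))// mulrC -ltr_pdivlMr//.
near: w; apply: cvgr_dist_lt => //; exact: divr_gt0.
Unshelve. all: by end_near.
Qed.

(** The norm [N] attains a minimum on the max-norm unit sphere, which is compact; this minimum is
    positive and serves as c, by homogeneity. *)
Lemma of_row_lower_bound :
  exists2 c : R, 0 < c & forall v, c * `|v| <= `|of_row v|.
Proof.
pose S := [set v : 'rV[R]_n | `|v| = 1].
have S_normalize v : v != 0 -> S (`|v|^-1 *: v).
  by move=> v0; rewrite /S/= normrZ normfV normr_id mulVf// normr_eq0.
(* If the sphere is empty (n = 0), every v is 0 and any constant works. *)
have [S0|/set0P/negP/negPn/eqP S0] := pselect (S !=set0); last first.
  exists 1 => // v; have [->|/S_normalize] := eqVneq v 0.
    by rewrite normr0 mulr0.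
  by rewrite S0.
have cS : compact S.
  apply: bounded_closed_compact.
    by exists 1; split => [|M M1 v /= ->]; [exact: real1|exact: ltW].
  apply: (@closed_comp _ _ (fun v : 'rV[R]_n => `|v|) [set x | x = 1]).
    by move=> v _; exact: norm_continuous.
  exact: closed_eq.
have [|v0 + v0_min] := @compact_EVT_min _ _ (fun v => `|of_row v|) S S0 cS.
  apply: continuous_subspaceT => v.
  by apply: continuous_comp; [exact: of_row_continuous|exact: norm_continuous].
rewrite inE => Sv0; exists `|of_row v0|.
  rewrite normr_gt0; apply/eqP => v00.
  have : v0 = 0 by rewrite -[v0]trmxK -[v0^T]/(of_row v0) v00 linear0.
  move: Sv0 => /[swap] ->; rewrite /S/= normr0 => /eqP.
  by rewrite eq_sym oner_eq0.
move=> v; have [->|v_neq0] := eqVneq v 0; first by rewrite normr0 mulr0.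
rewrite -ler_pdivlMr ?normr_gt0//.
have := v0_min (`|v|^-1 *: v); rewrite inE => /(_ (S_normalize _ v_neq0)).
have -> : of_row (`|v|^-1 *: v) = `|v|^-1 *: of_row v.
  by rewrite /of_row linearZ.
by rewrite normrZ normfV normr_id mulrC.
Qed.

Lemma normed_by_coord_continuous i :
  continuous (fun x : normed_by N => (x : 'cV[R]_n) i 0).
Proof.
have [c c0 le_c] := of_row_lower_bound.
move=> x; apply/(@cvgrPdist_lt _ _ _ (nbhs x)) => e e0; near=> y.
have -> : (x : 'cV[R]_n) i 0 - (y : 'cV[R]_n) i 0 =
    ((x - y : normed_by N) : 'cV[R]_n)^T 0 i.
  by rewrite !mxE.
apply: (le_lt_trans (coord_le_mx_norm _ _ _ _ _)).
rewrite -(ltr_pM2l c0); apply: (le_lt_trans (le_c _)).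
rewrite /of_row trmxK; near: y.
by apply: (@cvgr_dist_lt _ (normed_by N)) => //; exact: mulr_gt0.
Unshelve. all: by end_near.
Qed.

(** The ball is the image under [of_row] of a set of rows that is closed by continuity and bounded
    by [of_row_lower_bound]. *)
Lemma normed_by_closed_ball_compact (x0 : normed_by N) (r : R) :
  compact [set x | `|x - x0| <= r].
Proof.
have [c c0 le_c] := of_row_lower_bound.
have -> : [set x | `|x - x0| <= r] = of_row @` [set v | `|of_row v - x0| <= r].
  apply/seteqP; split => [x xr|_ [v vr <-]//].
  by exists x^T; rewrite /= /of_row trmxK.
apply: continuous_compact; first exact/continuous_subspaceT/of_row_continuous.
apply: bounded_closed_compact.
  exists (c^-1 * (r + `|x0|)); split; first exact: num_real.
  move=> M ltM v /= vr; apply/ltW/(le_lt_trans _ ltM).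
  rewrite mulrC ler_pdivlMr// mulrC (le_trans (le_c _))//.
  by rewrite -[of_row v](subrK x0) (le_trans (ler_normD _ _))// lerD2r.
apply: (@closed_comp _ _ (fun v => `|of_row v - x0|) [set x | x <= r]).
  move=> v _; apply: (@continuous_comp _ _ _ (fun v => of_row v - x0) Num.norm).
    apply: (@cvgB _ (normed_by N) _ (nbhs v)); last exact: cvg_cst.
    exact: of_row_continuous.
  exact: norm_continuous.
exact: closed_le.
Qed.

End FiniteDimension.

(** * Constraint slacks and upper semicontinuity of the feasible set *)

Section FeasibleSet.
Context {R : realType} {T : metricType R} {n : nat}.
Variables (NT : lmod_norm (Theta T n)) (NX : lmod_norm 'cV[R]_n).
Hypothesis NT_uniform : induces_uniform_topology NT.
Local Notation Fs := (F_SIP NT NX).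
Implicit Types (s y : normed_by NT) (x z : normed_by NX).

(** Sign convention: positive exactly when z violates the constraint t of y. *)
Definition slack (y : Theta T n) (z : 'cV[R]_n) (t : T) : R :=
  ((y.1 t)^T *m z) 0 0 - y.2 t.

Lemma slackE (y : Theta T n) (z : 'cV[R]_n) (t : T) :
  slack y z t = \sum_i y.1 t i 0 * z i 0 - y.2 t.
Proof.
by rewrite /slack mxE; congr (_ - _); apply: eq_bigr => i _; rewrite mxE.
Qed.

(** A product of two uniform balls is a neighborhood for uniform convergence, hence for [NT] by
    [NT_uniform]. *)
Lemma uniform_near s (e : R) : 0 < e ->
  nbhs s [set y : normed_by NT |
    forall t, `|s.1 t - y.1 t| < e /\ `|s.2 t - y.2 t| < e].
Proof.
move=> e0; rewrite NT_uniform.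
pose A := [set f : {uniform T -> 'cV[R]_n} | forall t, ball (s.1 t) e (f t)].
pose B := [set g : {uniform T -> R} | forall t, ball (s.2 t) e (g t)].
have nAB : nbhs (Theta_uniform s) (A `*` B).
  exists (A, B) => //.
  split; apply/uniform_nbhs.
    exists [set p | ball p.1 e p.2]; split.
      exact: (entourage_ball _ (PosNum e0)).
    by move=> h /= sh t; exact: sh.
  exists [set p | ball p.1 e p.2]; split.
    exact: (entourage_ball _ (PosNum e0)).
  by move=> h /= sh t; exact: sh.
have := @initial_continuous _ _ (@Theta_uniform R T n) s _ nAB.
apply: (@filterS _ (nbhs (s : initial_topology (@Theta_uniform R T n))) _
  (@Theta_uniform R T n @^-1` (A `*` B))) => y [/= y1 y2] t.
by have := y1 t; have := y2 t; rewrite -!ball_normE.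
Qed.

Lemma slack_near_le s z (e : R) : 0 < e ->
  \forall y \near s, forall t, slack y z t <= slack s z t + e.
Proof.
(* Coefficients within e / C move the slack at z by at most e / C times the sum of the |z_i|, plus e
   / C for the right-hand side: e in total. *)
move=> e0; pose C : R := \sum_i `|(z : 'cV[R]_n) i 0| + 1.
have C0 : 0 < C by rewrite ltr_wpDl// sumr_ge0.
have := @uniform_near s (e / C) (divr_gt0 e0 C0); apply: filterS => y sy t.
have [sy1 sy2] := sy t.
rewrite -lerBlDl; apply: (le_trans (ler_norm _)).
rewrite !slackE opprB (addrC (s.2 t)) addrACA -sumrB.
apply: (le_trans (ler_normD _ _)).
have -> : e = e / C * \sum_i `|(z : 'cV[R]_n) i 0| + e / C.
  by rewrite -[X in _ + X]mulr1 -mulrDr divfK// gt_eqF.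
apply: lerD; last by rewrite addrC; exact: ltW.
rewrite mulr_sumr (le_trans (ler_norm_sum _ _ _))//; apply: ler_sum => i _.
rewrite -mulrBl normrM ler_wpM2r// distrC.
apply: le_trans (ltW sy1).
by have := coord_le_mx_norm _ _ (s.1 t - y.1 t) i 0; rewrite !mxE.
Qed.

(** A fixed t is enough here: one violated constraint, still violated nearby, certifies
    infeasibility. *)
Lemma slack_cvg s z t :
  slack p.2 p.1 t @[p --> (z, s)] --> slack s z t.
Proof.
under eq_fun do rewrite slackE; rewrite slackE.
apply: cvgB; last first.
  apply: (@cvg_comp _ _ _ snd (fun y => y.2 t) _ (nbhs s)) => //.
    exact: cvg_snd.
  apply/cvgrPdist_lt => e e0.
  by have := uniform_near s _ e0; apply: filterS => y /(_ t)[].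
apply: cvg_big => [|i _]; first exact: add_continuous.
apply: cvgM.
  apply: (@cvg_comp _ _ _ snd (fun y => y.1 t i 0) _ (nbhs s)) => //.
    exact: cvg_snd.
  apply/cvgrPdist_lt => e e0.
  have := uniform_near s _ e0; apply: filterS => y /(_ t)[+ _].
  apply: le_lt_trans.
  by have := coord_le_mx_norm _ _ (s.1 t - y.1 t) i 0; rewrite !mxE.
apply: (@cvg_comp _ _ _ fst (fun x => (x : 'cV[R]_n) i 0) _ (nbhs z)).
  exact: cvg_fst.
exact: normed_by_coord_continuous.
Qed.

Lemma F_SIP_slack y z : Fs y z <-> forall t, slack y z t <= 0.
Proof. by split=> yz t; have := yz t; rewrite /slack subr_le0. Qed.

Lemma slack_segment (y : Theta T n) (x z : 'cV[R]_n) (l : R) t :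
  slack y (x + l *: (z - x)) t = (1 - l) * slack y x t + l * slack y z t.
Proof.
by rewrite /slack mulmxDr -scalemxAr mulmxBr !mxE; ring.
Qed.

Lemma F_SIP_near s x0 (r : R) (Q : normed_by NT -> normed_by NX -> Prop) :
  0 < r -> Fs s x0 -> (forall x, Fs s x -> `|x - x0| < r) ->
  (forall x, Fs s x -> \forall z \near x & y \near s, Fs y z -> Q y z) ->
  \forall y \near s, forall z, Fs y z -> Q y z.
Proof.
move=> r0 /F_SIP_slack sx0 lt_r nearQ.
(* The pair p is (y, e) with e a tolerance: x0, and so a point of the segment from x0 to z, is only
   known to be feasible for y up to e. *)
pose P (p : normed_by NT * R) z := (forall t, slack p.1 z t <= p.2) ->
  `|z - x0| < r /\ (Fs p.1 z -> Q p.1 z).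
have : \forall p \near filter_prod (nbhs s) (0 : R)^'+,
    [set z : normed_by NX | `|z - x0| <= r] `<=` P p.
  (* Compactness in covering form: it suffices to prove [P] locally around each z of the ball. *)
  have /compact_near_coveringP := @normed_by_closed_ball_compact _ _ NX x0 r.
  apply => z _.
  have [sz|/existsNP[t /negP]] := pselect (forall t, slack s z t <= 0).
    have /F_SIP_slack Fz := sz.
    have [[A B] /= [zA sB] QAB] := nearQ _ Fz.
    exists (A `&` [set z' | `|z' - x0| < r], B `*` setT) => /=.
      split.
        apply: (@filterI _ (nbhs z)) => //.
        have dist_cvg : `|z' - x0| @[z' --> z] --> `|z - x0|.
          apply: (@continuous_comp _ _ _ (fun z' => z' - x0) Num.norm).
            by apply: (@cvgB _ (normed_by NX) _ (nbhs z)) => //; exact: cvg_cst.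
          exact: norm_continuous.
        exact: (cvgr_lt _ dist_cvg _ (lt_r _ Fz)).
      by exists (B, setT) => //=; split => //; exact: filterT.
    move=> [z' [y e]] /= [[Az' z'r] [By _]] _; split=> // Fyz'.
    exact: (QAB (z', y)).
  (* Here z violates the constraint t for s. Near (z, s) the slack stays above m, half its value at
     (z, s), so tolerances e < m make the premise of [P] false. *)
  rewrite -ltNge => tz.
  have [[A B] /= [zA sB] gtAB] :=
    cvgr_gt _ (slack_cvg s z t) _ (midf_lt tz).2.
  set m := (0 + _) / 2 in gtAB.
  have m0 : 0 < m by exact: (midf_lt tz).1.
  exists (A, B `*` [set e | e < m]) => /=.
    split=> //; exists (B, [set e | e < m]) => //=; split=> //.
    exact: nbhs_right_lt.
  move=> [z' [y e]] /= [Az' [By em]] /(_ t) /= te.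
  have := gtAB (z', y) (conj Az' By); rewrite /= => /lt_le_trans/(_ te).
  by move=> /lt_trans/(_ em); rewrite ltxx.
move=> [[A B] /= [sA B0] ABP].
have [e [Be e0]] : exists e, B e /\ 0 < e.
  have /filter_ex[e [Be e0]] : \forall e \near 0^'+, B e /\ 0 < e.
    by apply: filterI => //; exact: nbhs_right_gt.
  by exists e.
suff AQ (y : normed_by NT) (z : normed_by NX) :
    A y -> (forall t, slack y x0 t <= e) -> Fs y z -> Q y z.
  near=> y => z; apply: AQ; near: y => //.
  apply: filterS (slack_near_le s x0 _ e0) => y yx0 t.
  by rewrite (le_trans (yx0 t))// gerDr.
move=> Ay yx0 Fyz.
have yz t : slack y z t <= e.
  by move/F_SIP_slack: Fyz => /(_ t)/le_trans; apply; exact: ltW.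
have [zr|rz] := leP `|z - x0| r.
  by have [_] := ABP (y, e) (conj Ay Be) z zr yz; exact.
have z_gt0 : 0 < `|z - x0| by exact: lt_trans rz.
(* This l puts the point of the segment at distance exactly r from x0: it is in the closed ball and
   feasible up to e, yet [P] then demands a distance < r. *)
pose l := r / `|z - x0|.
have l0 : 0 < l by exact: divr_gt0.
have l1 : l <= 1 by rewrite ler_pdivrMr// mul1r ltW.
have dw : `|(x0 + l *: (z - x0)) - x0| = r.
  by rewrite addrAC subrr add0r normrZ gtr0_norm// divfK// gt_eqF.
have yw t : slack y (x0 + l *: (z - x0)) t <= e.
  rewrite slack_segment.
  have -> : e = (1 - l) * e + l * e by rewrite mulrBl mul1r subrK.
  by apply: lerD; rewrite ler_wpM2l// ?subr_ge0// ltW.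
have wr : `|(x0 + l *: (z - x0)) - x0| <= r by rewrite dw.
by have [] := ABP (y, e) (conj Ay Be) _ wr yw; rewrite dw ltxx.
Unshelve. all: by end_near.
Qed.

End FeasibleSet.

(** * Comparison of the two moduli *)

Lemma clm_le_Lipusc (R : realType) (Y X : metricType R) (M : Y -> set X) y0 x0 :
  (clm M y0 x0 <= Lipusc M y0)%E.
Proof.
apply: ereal_inf_le_tmp => _ [k [k0 [V y0V le_k]] <-].
exists k => //; split=> //.
exists V, setT; split=> //; first exact: filterT.
by move=> y x Vy Mx _; exact: le_k.
Qed.

Lemma clm_ge0 (R : realType) (Y X : metricType R) (M : Y -> set X) y0 x0 :
  (0 <= clm M y0 x0)%E.
Proof. by apply: le_ereal_inf_tmp => _ [k [k0 _] <-]; rewrite lee_fin. Qed.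

Theorem theorem4 (R : realType) (T : metricType R) (n : nat)
    (T_compact : compact [set: T])
    (NT : lmod_norm (Theta T n)) (NX : lmod_norm 'cV[R]_n)
    (NT_uniform : induces_uniform_topology NT)
    (s : normed_by NT) (s_dom : svdom (F_SIP NT NX) s)
    (Fs_bounded : bounded_set (F_SIP NT NX s)) :
  Lipusc (F_SIP NT NX) s =
  ereal_sup [set clm (F_SIP NT NX) s x | x in F_SIP NT NX s].
Proof.
apply/eqP; rewrite eq_le; apply/andP; split; last first.
  by apply: ge_ereal_sup => _ [x _ <-]; exact: clm_le_Lipusc.
have [x0 Fx0] := s_dom.
have [r r0 lt_r] : exists2 r : R, 0 < r &
    forall x : normed_by NX, F_SIP NT NX s x -> `|x - x0| < r.
  have /ex_strict_bound_gt0[M M0 ltM] := Fs_bounded.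
  exists (M + M) => [|x Fx]; first exact: addr_gt0.
  by rewrite (le_lt_trans (ler_normB _ _))// ltrD// ltM.
set S := ereal_sup _.
have le_S x : F_SIP NT NX s x -> (clm (F_SIP NT NX) s x <= S)%E.
  by move=> Fx; apply: ereal_sup_ubound; exists x.
have [->|S_neq] := eqVneq S +oo%E; first exact: leey.
(* The point x0 of the feasible set gives S >= 0; over an empty set the supremum would be -oo. *)
have S_fin : S \is a fin_num.
  by rewrite ge0_fin_numE ?ltey// (le_trans _ (le_S _ Fx0))// clm_ge0.
apply/lee_addgt0Pr => e e0; apply: ereal_inf_lbound.
have S0 : 0 <= fine S by rewrite fine_ge0// (le_trans _ (le_S _ Fx0))// clm_ge0.
exists (fine S + e); last by rewrite EFinD fineK.
split; first by rewrite addr_ge0// ltW.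
pose Q (y : normed_by NT) (z : normed_by NX) :=
  (dist_to_set z (F_SIP NT NX s) <= ((fine S + e) * mdist y s)%:E)%E.
have nearQ : nbhs s [set y | forall z, F_SIP NT NX y z -> Q y z].
  apply: (F_SIP_near _ _ NT_uniform s x0 r) => // x Fx.
  (* The calmness constant k depends on x but lies below the common bound [fine S + e], which can
     replace it. *)
  have : (clm (F_SIP NT NX) s x < (fine S + e)%:E)%E.
    by rewrite (le_lt_trans (le_S _ Fx))// EFinD fineK// lteDl// lte_fin.
  move=> /ereal_inf_lt[_ [k [k0 [V [U [sV xU le_k]]]] <-]].
  rewrite lte_fin => k_lt.
  exists (U, V) => // -[z y] [/= Uz Vy] Fyz.
  rewrite /Q (le_trans (le_k y z Vy Fyz Uz))// lee_fin ler_wpM2r ?mdist_ge0//.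
  exact: ltW.
by exists [set y | forall z, F_SIP NT NX y z -> Q y z] => // y z; exact.
Qed.
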